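(* Let $A,B\in\mathbb{P}_n^+$ and let $g,h$ be matrix monotone functions on $[0,\infty)$ taking positive values on $(0,\infty)$, such that for all $x>0$: (i) $g\!\left(\frac{1}{h(x)}\right)\le \frac{1}{h(g(x))}$; (ii) $g\!\left(\frac{x}{h(x)}\right)\le \frac{g(x)}{h(g(x))}$; (iii) $h(x g(x))\le h(x)\,h(g(x))$. Let $f(x)=xg(x)$ and let $f^{k}=f\circ\cdots\circ f$ ($k$-fold composition). Then for every positive integer $k$, $$A\sigma_h B\le I\quad\Longrightarrow\quad f^{k}(A)\,\sigma_h\, f^{k}(B)\le I.$$ If all three inequalities (i)–(iii) are reversed, then for every positive integer $k$, $$A\sigma_h B\ge I\quad\Longrightarrow\quad f^{k}(A)\,\sigma_h\, f^{k}(B)\ge I.$$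
   Context: $\mathbb{P}_n^+$ denotes the set of $n\times n$ complex positive definite matrices, $I$ the identity, $\le$ the Löwner order, and $f(A)$ is defined by functional calculus. A real function $h$ is matrix monotone if $X\le Y$ implies $h(X)\le h(Y)$ for Hermitian matrices of all sizes with spectra in its domain. For a positive matrix monotone function $h$ and $A,B\in\mathbb{P}_n^+$, $A\sigma_h B:=A^{1/2}h(A^{-1/2}BA^{-1/2})A^{1/2}$. *)

(* Defs.v *)
From HB Require Import structures.
From mathcomp Require Import all_boot all_order all_algebra.
From mathcomp Require Import sesquilinear spectral.
From mathcomp Require Import reals.
From mathcomp Require Import complex.
Set Implicit Arguments. Unset Strict Implicit. Unset Printing Implicit Defensive.
Import Order.TTheory GRing.Theory Num.Theory.
Local Open Scope ring_scope.

Definition adjmx (R : realType) m n (M : 'M[R[i]]_(m, n)) : 'M[R[i]]_(n, m) :=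
  map_mx (@Num.conj _) (M ^T).

Definition psdmx (R : realType) n (M : 'M[R[i]]_n) : Prop :=
  M \is hermsymmx /\ forall v : 'rV[R[i]]_n, 0 <= (v *m M *m adjmx v) 0 0.

Definition pdmx (R : realType) n (M : 'M[R[i]]_n) : Prop :=
  M \is hermsymmx /\ forall v : 'rV[R[i]]_n, v != 0 -> 0 < (v *m M *m adjmx v) 0 0.

Definition loewner_le (R : realType) n (A B : 'M[R[i]]_n) : Prop := psdmx (B - A).

(* functional calculus f(A) for a Hermitian A = P^-1 diag(lambda) P (P unitary):
   f(A) := P^-1 diag(f(lambda)) P  (eigenvalues of a Hermitian matrix are real) *)
Definition fcalc (R : realType) (f : R -> R) n (A : 'M[R[i]]_n) : 'M[R[i]]_n :=
  invmx (spectralmx A)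
  *m diag_mx (map_mx (fun z : R[i] => ((f (complex.Re z))%:C)%C) (spectral_diag A))
  *m spectralmx A.

Definition matrix_monotone0 (R : realType) (h : R -> R) : Prop :=
  forall n (X Y : 'M[R[i]]_n), psdmx X -> psdmx Y ->
    loewner_le X Y -> loewner_le (fcalc h X) (fcalc h Y).

Definition msigma (R : realType) (h : R -> R) n (A B : 'M[R[i]]_n) : 'M[R[i]]_n :=
  let Ah := fcalc (@Num.sqrt R) A in
  let Amh := fcalc (fun x => (Num.sqrt x)^-1) A in
  Ah *m fcalc h (Amh *m B *m Amh) *m Ah.

(* Main.v *)
Require Import Defs.
From HB Require Import structures.
From mathcomp Require Import all_boot all_order all_algebra.
From mathcomp Require Import sesquilinear spectral.
From mathcomp Require Import reals.
From mathcomp Require Import complex.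
From mathcomp Require Import ring.
Set Implicit Arguments.
Unset Strict Implicit.
Unset Printing Implicit Defensive.
Import Order.TTheory GRing.Theory Num.Theory.
Local Open Scope ring_scope.

(* Put [C = A^(-1/2) B A^(-1/2)]. If [A s_h B <= I] then [A <= 1/h(C)], and matrix
   monotonicity of [g] with (i) and (ii) bounds [f A] by [A^(1/2) (1/h(g C)) A^(1/2)]
   and [f B] by [A^(1/2) (C g(C) / h(g C)) A^(1/2)]. The mean [s_h] is monotone in both
   arguments, and by (iii) the mean of the two bounds is at most
   [A^(1/2) h(C) A^(1/2) = A s_h B <= I]; then iterate. Monotonicity of the mean in its
   first argument is Hansen's inequality [K^* h(X) K <= h(K^* X K)] for contractions [K],
   obtained by compressing with an isometry. As [h 0] may be negative, positive definite
   matrices are used throughout. *)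

(** * Adjoints, positive matrices and the Löwner order *)

Lemma conj_real_complex (R : realType) (x : R) : Num.conj (x%:C)%C = (x%:C)%C :> R[i].
Proof. by apply/CrealP; apply/complex_realP; exists x. Qed.

Lemma adjmxM (R : realType) m n p (A : 'M[R[i]]_(m, n)) (B : 'M[R[i]]_(n, p)) :
  adjmx (A *m B) = adjmx B *m adjmx A.
Proof. by rewrite /adjmx trmx_mul map_mxM. Qed.

Lemma adjmxK (R : realType) m n (A : 'M[R[i]]_(m, n)) : adjmx (adjmx A) = A.
Proof. by apply/matrixP=> i j; rewrite !mxE conjCK. Qed.

Lemma adjmxD (R : realType) m n (A B : 'M[R[i]]_(m, n)) :
  adjmx (A + B) = adjmx A + adjmx B.
Proof. by apply/matrixP=> i j; rewrite !mxE rmorphD. Qed.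

Lemma adjmxB (R : realType) m n (A B : 'M[R[i]]_(m, n)) :
  adjmx (A - B) = adjmx A - adjmx B.
Proof. by apply/matrixP=> i j; rewrite !mxE rmorphB. Qed.

Lemma adjmxZ (R : realType) m n (c : R) (A : 'M[R[i]]_(m, n)) :
  adjmx ((c%:C)%C *: A) = (c%:C)%C *: adjmx A.
Proof. by apply/matrixP=> i j; rewrite !mxE rmorphM /= conj_real_complex. Qed.

Lemma adjmx1 (R : realType) n : adjmx (1%:M : 'M[R[i]]_n) = 1%:M.
Proof. by rewrite /adjmx trmx1 map_mx1. Qed.

Lemma adjmx_scalar (R : realType) n (c : R) :
  adjmx ((c%:C)%C%:M : 'M[R[i]]_n) = (c%:C)%C%:M.
Proof. by rewrite /adjmx tr_scalar_mx map_scalar_mx /= conj_real_complex. Qed.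

Lemma adjmx_col (R : realType) m n p (A : 'M[R[i]]_(m, p)) (B : 'M[R[i]]_(n, p)) :
  adjmx (col_mx A B) = row_mx (adjmx A) (adjmx B).
Proof. by rewrite /adjmx tr_col_mx map_row_mx. Qed.

Lemma hermsymmxP (R : realType) n (A : 'M[R[i]]_n) :
  A \is hermsymmx <-> adjmx A = A.
Proof.
rewrite is_hermitianmxE expr0 scale1r; split=> [/eqP|] eA; first exact: esym.
exact/eqP/esym.
Qed.

Lemma psdmx_adj (R : realType) n (A : 'M[R[i]]_n) : psdmx A -> adjmx A = A.
Proof. by case=> /hermsymmxP. Qed.

Lemma pdmx_adj (R : realType) n (A : 'M[R[i]]_n) : pdmx A -> adjmx A = A.
Proof. by case=> /hermsymmxP. Qed.

Lemma pdmx_psd (R : realType) n (A : 'M[R[i]]_n) : pdmx A -> psdmx A.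
Proof.
case=> hA pA; split=> // v.
by have [->|/pA/ltW//] := eqVneq v 0; rewrite !mul0mx mxE.
Qed.

Lemma adjmx_congr (R : realType) m n (M : 'M[R[i]]_n) (X : 'M[R[i]]_(n, m)) :
  adjmx M = M -> adjmx (adjmx X *m M *m X) = adjmx X *m M *m X.
Proof. by move=> hM; rewrite !adjmxM adjmxK hM mulmxA. Qed.

Lemma psdmx_congr (R : realType) m n (M : 'M[R[i]]_n) (X : 'M[R[i]]_(n, m)) :
  psdmx M -> psdmx (adjmx X *m M *m X).
Proof.
move=> pM; split; first by apply/hermsymmxP/adjmx_congr/psdmx_adj.
move=> v; case: pM => _ /(_ (v *m adjmx X)).
by rewrite adjmxM adjmxK !mulmxA.
Qed.

Lemma pdmx_congr (R : realType) n (M X : 'M[R[i]]_n) :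
  X \in unitmx -> pdmx M -> pdmx (adjmx X *m M *m X).
Proof.
move=> uX pM; split; first by apply/hermsymmxP/adjmx_congr/pdmx_adj.
move=> v vn0; case: pM => _ /(_ (v *m adjmx X)).
rewrite adjmxM adjmxK !mulmxA; apply; apply: contraNneq vn0 => v0; apply/eqP.
by rewrite -[v]mulmx1 -(@adjmx1 R) -(mulVmx uX) adjmxM mulmxA v0 mul0mx.
Qed.

Lemma psdmxD (R : realType) n (A B : 'M[R[i]]_n) :
  psdmx A -> psdmx B -> psdmx (A + B).
Proof.
move=> pA pB; split.
  by apply/hermsymmxP; rewrite adjmxD !psdmx_adj.
by move=> v; rewrite mulmxDr mulmxDl mxE addr_ge0 ?(pA.2 v) ?(pB.2 v).
Qed.

Lemma psdmx0 (R : realType) n : psdmx (0 : 'M[R[i]]_n).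
Proof.
split; first by apply/hermsymmxP; rewrite /adjmx trmx0 map_mx0.
by move=> v; rewrite mulmx0 mul0mx mxE.
Qed.

Lemma psdmxZ (R : realType) n (c : R) (A : 'M[R[i]]_n) :
  0 <= c -> psdmx A -> psdmx ((c%:C)%C *: A).
Proof.
move=> c0 pA; split; first by apply/hermsymmxP; rewrite adjmxZ psdmx_adj.
move=> v; rewrite -scalemxAr -scalemxAl mxE mulr_ge0 ?ler0c //; exact: pA.2.
Qed.

Lemma loewner_refl (R : realType) n (A : 'M[R[i]]_n) : loewner_le A A.
Proof. by rewrite /loewner_le subrr; exact: psdmx0. Qed.

Lemma loewner_trans (R : realType) n (A B C : 'M[R[i]]_n) :
  loewner_le A B -> loewner_le B C -> loewner_le A C.
Proof.
move=> AB BC; rewrite /loewner_le.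
have -> : C - A = (C - B) + (B - A) by rewrite addrA subrK.
exact: psdmxD BC AB.
Qed.

Lemma loewner_congr (R : realType) m n (A B : 'M[R[i]]_n) (X : 'M[R[i]]_(n, m)) :
  loewner_le A B ->
  loewner_le (adjmx X *m A *m X) (adjmx X *m B *m X).
Proof. by rewrite /loewner_le -mulmxBl -mulmxBr; exact: psdmx_congr. Qed.

Lemma psdmx1 (R : realType) n : psdmx (1%:M : 'M[R[i]]_n).
Proof.
split; first by apply/hermsymmxP; rewrite adjmx1.
move=> v; rewrite mulmx1 mxE sumr_ge0 // => i _.
by rewrite !mxE mul_conjC_ge0.
Qed.

Lemma psdmx_scalar (R : realType) n (c : R) :
  0 <= c -> psdmx ((c%:C)%C%:M : 'M[R[i]]_n).
Proof. by move=> c0; rewrite -scalemx1; apply/psdmxZ/psdmx1. Qed.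

(** * Spectral representation and functional calculus *)

Definition rdiag (R : realType) n (e : 'rV[R]_n) : 'M[R[i]]_n :=
  diag_mx (map_mx (real_complex R) e).

(** The rows of [P] are orthonormal eigenvectors. Keeping the eigenvalues in [R] lets a real
    function act on them directly, and leaving [P] arbitrary frees later arguments from the
    particular choice [spectralmx]. *)
Definition spectral_rep (R : realType) n (P : 'M[R[i]]_n) (e : 'rV[R]_n) (A : 'M[R[i]]_n) :=
  P *m adjmx P = 1%:M /\ A = adjmx P *m rdiag e *m P.

Lemma adjmx_rdiag (R : realType) n (e : 'rV[R]_n) : adjmx (rdiag e) = rdiag e.
Proof.
rewrite /adjmx /rdiag tr_diag_mx map_diag_mx; congr diag_mx.
by apply/matrixP=> i j; rewrite !mxE /= conj_real_complex.
Qed.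

Lemma rdiagM (R : realType) n (d e : 'rV[R]_n) :
  rdiag d *m rdiag e = rdiag (\row_j (d 0 j * e 0 j)).
Proof.
rewrite mulmx_diag; congr diag_mx.
by apply/matrixP=> i j; rewrite !mxE rmorphM.
Qed.

(** Entrywise the hypothesis says [(d_i - e_j) X_ij = 0]: either the entry vanishes or the two
    eigenvalues agree, and then so do their images under [f]. *)
Lemma rdiag_intertwine (R : realType) (f : R -> R) m n (d : 'rV[R]_m) (e : 'rV[R]_n)
    (X : 'M[R[i]]_(m, n)) :
  rdiag d *m X = X *m rdiag e ->
  rdiag (map_mx f d) *m X = X *m rdiag (map_mx f e).
Proof.
move=> eX; apply/matrixP=> i j.
move/matrixP: eX => /(_ i j); rewrite !mul_diag_mx !mul_mx_diag !mxE.
rewrite [_ * X i j]mulrC => /eqP; rewrite -subr_eq0 -mulrBr mulf_eq0 subr_eq0.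
case/orP=> [/eqP->|/eqP/complexI->]; first by rewrite mulr0 mul0r.
by rewrite mulrC.
Qed.

Lemma spectral_rep_unitary (R : realType) n (P A : 'M[R[i]]_n) e :
  spectral_rep P e A -> adjmx P *m P = 1%:M.
Proof. by case=> /mulmx1C. Qed.

Lemma spectral_rep_adj (R : realType) n (P A : 'M[R[i]]_n) e : spectral_rep P e A -> adjmx A = A.
Proof. by case=> _ ->; apply/adjmx_congr/adjmx_rdiag. Qed.

Lemma fcalc_spec_ex (R : realType) n (A : 'M[R[i]]_n) :
  adjmx A = A -> exists P e, spectral_rep P e A /\
    forall f, fcalc f A = adjmx P *m rdiag (map_mx f e) *m P.
Proof.
move=> /hermsymmxP hA.
have uP := spectral_unitarymx A.
exists (spectralmx A), (map_mx (@complex.Re R) (spectral_diag A)).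
have PV : invmx (spectralmx A) = adjmx (spectralmx A).
  by rewrite invmx_unitary // /adjmx map_trmx.
split; last first.
  move=> f; rewrite /fcalc PV; congr (_ *m diag_mx _ *m _).
  by apply/matrixP=> i j; rewrite !mxE.
split; first by rewrite -PV mulmxV ?spectral_unit.
have /orthomx_spectralP {1}-> := hermitian_normalmx hA.
rewrite PV; congr (_ *m diag_mx _ *m _).
(* Hermitian matrices have real eigenvalues, so taking real parts loses nothing. *)
apply/matrixP=> i j; rewrite !mxE RRe_real //.
by have /mxOverP := hermitian_spectral_diag_real hA; apply.
Qed.

(** In eigenbases of [A] and [B] the relation becomes one between diagonal matrices, for arbitrary
    [f]. As [X] may be rectangular, this serves for isometries, block inclusions and unitaries, and
    for carrying [g] from one ordering of a product to the other. *)
Lemma fcalc_intertwine (R : realType) (f : R -> R) m n (A : 'M[R[i]]_m)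
    (B : 'M[R[i]]_n) (X : 'M[R[i]]_(m, n)) :
  adjmx A = A -> adjmx B = B -> A *m X = X *m B ->
  fcalc f A *m X = X *m fcalc f B.
Proof.
move=> /fcalc_spec_ex[P [d [sA ->]]] /fcalc_spec_ex[Q [e [sB ->]]].
have PP := spectral_rep_unitary sA; have QQ := spectral_rep_unitary sB.
case: sA sB => PP' -> [QQ' ->] eX.
have /(rdiag_intertwine f) : rdiag d *m (P *m X *m adjmx Q) =
                             (P *m X *m adjmx Q) *m rdiag e.
  move/(congr1 (fun M => P *m M *m adjmx Q)): eX.
  by rewrite !mulmxA PP' mul1mx -[_ *m Q *m _]mulmxA QQ' mulmx1.
move=> /(congr1 (fun M => adjmx P *m M *m Q)).
rewrite !mulmxA PP mul1mx -[_ *m adjmx Q *m Q]mulmxA QQ mulmx1.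
by move=> ->.
Qed.

(** The calculus does not depend on the diagonalisation: the change of basis [Q *m adjmx P]
    intertwines the two diagonal matrices, hence also their images under [f]. *)
Lemma spectral_rep_fcalcE (R : realType) (f : R -> R) n (P A : 'M[R[i]]_n) e :
  spectral_rep P e A -> fcalc f A = adjmx P *m rdiag (map_mx f e) *m P.
Proof.
move=> sA; have hA := spectral_rep_adj sA; have PP := spectral_rep_unitary sA.
have [Q [d [sB ->]]] := fcalc_spec_ex hA.
have QQ := spectral_rep_unitary sB; case: sA sB => PP' -> [QQ' eA].
have /(rdiag_intertwine f) : rdiag d *m (Q *m adjmx P) = Q *m adjmx P *m rdiag e.
  move/(congr1 (fun M => Q *m M *m adjmx P)): eA.
  by rewrite !mulmxA QQ' mul1mx -[_ *m P *m _]mulmxA PP' mulmx1.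
move=> /(congr1 (fun M => adjmx Q *m M *m P)).
by rewrite !mulmxA QQ mul1mx -[_ *m adjmx P *m P]mulmxA PP mulmx1.
Qed.

Lemma spectral_rep_fcalc (R : realType) (f : R -> R) n (P A : 'M[R[i]]_n) e :
  spectral_rep P e A -> spectral_rep P (map_mx f e) (fcalc f A).
Proof. by move=> sA; split; [case: sA|exact: spectral_rep_fcalcE]. Qed.

Lemma spectral_repP (R : realType) n (A : 'M[R[i]]_n) :
  adjmx A = A -> exists P e, spectral_rep P e A.
Proof. by move=> /fcalc_spec_ex[P [e [sA _]]]; exists P, e. Qed.

Lemma fcalc_adj (R : realType) (f : R -> R) n (A : 'M[R[i]]_n) :
  adjmx A = A -> adjmx (fcalc f A) = fcalc f A.
Proof. by move=> /spectral_repP[P [e /(spectral_rep_fcalc f)/spectral_rep_adj]]. Qed.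

Lemma fcalc_comp (R : realType) (f g : R -> R) n (A : 'M[R[i]]_n) :
  adjmx A = A -> fcalc f (fcalc g A) = fcalc (fun x => f (g x)) A.
Proof.
move=> /spectral_repP[P [e sA]]; rewrite (spectral_rep_fcalcE _ (spectral_rep_fcalc g sA)).
rewrite (spectral_rep_fcalcE _ sA); congr (_ *m rdiag _ *m _).
by apply/matrixP=> i j; rewrite !mxE.
Qed.

Lemma fcalcM (R : realType) (f g : R -> R) n (A : 'M[R[i]]_n) :
  adjmx A = A -> fcalc f A *m fcalc g A = fcalc (fun x => f x * g x) A.
Proof.
move=> /spectral_repP[P [e sA]]; rewrite !(spectral_rep_fcalcE _ sA).
rewrite !mulmxA -[_ *m P *m adjmx P]mulmxA sA.1 mulmx1.
rewrite -[_ *m rdiag _ *m rdiag _]mulmxA rdiagM; congr (_ *m rdiag _ *m _).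
by apply/matrixP=> i j; rewrite !mxE ord1.
Qed.

Lemma fcalc_id (R : realType) n (A : 'M[R[i]]_n) :
  adjmx A = A -> fcalc (fun x => x) A = A.
Proof.
move=> /spectral_repP[P [e sA]]; rewrite (spectral_rep_fcalcE _ sA) [RHS]sA.2.
by congr (_ *m rdiag _ *m _); apply/matrixP=> i j; rewrite !mxE.
Qed.

Lemma fcalc_cst (R : realType) (c : R) n (A : 'M[R[i]]_n) :
  adjmx A = A -> fcalc (fun=> c) A = (c%:C)%C%:M.
Proof.
move=> /spectral_repP[P [e sA]]; rewrite (spectral_rep_fcalcE _ sA).
have -> : rdiag (map_mx (fun=> c) e) = (c%:C)%C%:M.
  by rewrite -diag_const_mx; congr diag_mx; apply/matrixP=> i j; rewrite !mxE.
by rewrite mul_mx_scalar -scalemxAl (spectral_rep_unitary sA) scalemx1.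
Qed.

Lemma fcalc_scalar (R : realType) (f : R -> R) n (c : R) :
  fcalc f ((c%:C)%C%:M : 'M[R[i]]_n) = ((f c)%:C)%C%:M.
Proof.
rewrite (@spectral_rep_fcalcE _ _ _ 1%:M _ (const_mx c)).
  rewrite adjmx1 mul1mx mulmx1 -diag_const_mx; congr diag_mx.
  by apply/matrixP=> i j; rewrite !mxE.
split; rewrite adjmx1 ?mulmx1 // mul1mx -diag_const_mx; congr diag_mx.
by apply/matrixP=> i j; rewrite !mxE.
Qed.

(** * Positivity read off the eigenvalues *)

Lemma spectral_rep_quad (R : realType) n (P A : 'M[R[i]]_n) e (v : 'rV_n) :
  spectral_rep P e A -> (v *m A *m adjmx v) 0 0 =
    \sum_i ((e 0 i)%:C)%C * `|(v *m adjmx P) 0 i| ^+ 2.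
Proof.
case=> _ ->; have -> : v *m (adjmx P *m rdiag e *m P) *m adjmx v =
    (v *m adjmx P) *m rdiag e *m adjmx (v *m adjmx P).
  by rewrite adjmxM adjmxK !mulmxA.
rewrite mxE; apply: eq_bigr => i _; rewrite mul_mx_diag !mxE.
by rewrite mulrC mulrA mulrC normCKC.
Qed.

Lemma spectral_rep_eig (R : realType) n (P A : 'M[R[i]]_n) e j :
  spectral_rep P e A -> (row j P *m A *m adjmx (row j P)) 0 0 = ((e 0 j)%:C)%C.
Proof.
move=> sA; rewrite (spectral_rep_quad _ sA) -row_mul sA.1 (bigD1 j) //= big1.
  by rewrite !mxE eqxx normr1 expr1n mulr1 addr0.
move=> i ij; rewrite !mxE [j == i]eq_sym (negPf ij) normr0 expr0n mulr0.
by [].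
Qed.

Lemma spectral_rep_psd (R : realType) n (P A : 'M[R[i]]_n) e :
  spectral_rep P e A -> psdmx A <-> forall j, 0 <= e 0 j.
Proof.
move=> sA; split=> [pA j|e0].
  by rewrite -ler0c -(spectral_rep_eig _ sA); exact: pA.2.
split; first exact/hermsymmxP/(spectral_rep_adj sA).
move=> v; rewrite (spectral_rep_quad _ sA) sumr_ge0 // => i _.
by rewrite mulr_ge0 ?ler0c // exprn_ge0.
Qed.

Lemma spectral_rep_pd (R : realType) n (P A : 'M[R[i]]_n) e :
  spectral_rep P e A -> pdmx A <-> forall j, 0 < e 0 j.
Proof.
move=> sA; split=> [pA j|e0].
  rewrite -ltcR -(spectral_rep_eig _ sA); apply: pA.2; apply/eqP=> rP0.
  have /matrixP/(_ 0 j) : row j P *m adjmx P = 0 by rewrite rP0 mul0mx.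
  by rewrite -row_mul sA.1 !mxE eqxx => /eqP; rewrite oner_eq0.
split; first exact/hermsymmxP/(spectral_rep_adj sA).
move=> v vn0; have pA : psdmx A.
  by apply/(spectral_rep_psd sA) => j; apply: ltW.
(* If the form vanishes at [v], each nonnegative summand does; since the eigenvalues are nonzero,
   all coordinates of [v] in the eigenbasis are zero. *)
rewrite lt_neqAle pA.2 andbT eq_sym; apply: contraNneq vn0 => /eqP.
rewrite (spectral_rep_quad _ sA) psumr_eq0; last first.
  by move=> i _; rewrite mulr_ge0 ?exprn_ge0 // ler0c ltW.
move=> /allP v0; have vP : v *m adjmx P = 0.
  apply/rowP=> i; rewrite [RHS]mxE; apply/eqP.
  have := v0 i (mem_index_enum i); rewrite mulf_eq0 expf_eq0 /= normr_eq0.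
  by case/orP => // /eqP/complexI ei; move: (e0 i); rewrite ei ltxx.
by rewrite -[v]mulmx1 -(spectral_rep_unitary sA) mulmxA vP mul0mx.
Qed.

Lemma fcalc_pd (R : realType) (f : R -> R) n (A : 'M[R[i]]_n) :
  (forall x : R, 0 < x -> 0 < f x) -> pdmx A -> pdmx (fcalc f A).
Proof.
move=> f0 pA; have [P [e sA]] := spectral_repP (pdmx_adj pA).
apply/(spectral_rep_pd (spectral_rep_fcalc f sA)) => j; rewrite mxE.
by apply: f0; move: j; apply/(spectral_rep_pd sA).
Qed.

Lemma fcalcB (R : realType) (f g : R -> R) n (A : 'M[R[i]]_n) :
  adjmx A = A -> fcalc f A - fcalc g A = fcalc (fun x => f x - g x) A.
Proof.
move=> /spectral_repP[P [e sA]]; rewrite !(spectral_rep_fcalcE _ sA) -mulmxBl -mulmxBr.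
rewrite /rdiag -raddfB; congr (_ *m diag_mx _ *m _).
by apply/matrixP=> i j; rewrite !mxE -rmorphB.
Qed.

(** All eigenvalues lie in the open half-line, so the functions need to be compared only there; the
    conventions for inverse and square root outside it never enter. *)
Lemma fcalc_le (R : realType) (f g : R -> R) n (A : 'M[R[i]]_n) :
  pdmx A -> (forall x : R, 0 < x -> f x <= g x) -> loewner_le (fcalc f A) (fcalc g A).
Proof.
move=> pA fg; have [P [e sA]] := spectral_repP (pdmx_adj pA).
rewrite /loewner_le fcalcB ?pdmx_adj //.
apply/(spectral_rep_psd (spectral_rep_fcalc _ sA)) => j; rewrite mxE subr_ge0.
by apply: fg; move: j; apply/(spectral_rep_pd sA).
Qed.

Lemma fcalc_eq (R : realType) (f g : R -> R) n (A : 'M[R[i]]_n) :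
  pdmx A -> (forall x : R, 0 < x -> f x = g x) -> fcalc f A = fcalc g A.
Proof.
move=> pA fg; have [P [e sA]] := spectral_repP (pdmx_adj pA).
rewrite !(spectral_rep_fcalcE _ sA); congr (_ *m rdiag _ *m _).
apply/matrixP=> i j; rewrite ord1 !mxE; apply: fg.
by move: j; apply/(spectral_rep_pd sA).
Qed.

Lemma pdmx_ge_scalar (R : realType) n (A : 'M[R[i]]_n) :
  pdmx A -> exists2 c : R, 0 < c & loewner_le ((c%:C)%C%:M) A.
Proof.
move=> pA; have [P [e sA]] := spectral_repP (pdmx_adj pA).
have e0 : forall j, 0 < e 0 j by apply/(spectral_rep_pd sA).
have [c c0 ce] : exists2 c : R, 0 < c & forall j, c <= e 0 j.
  (* The default value 1 keeps the minimum positive when [n] is 0. *)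
  exists (\big[Num.min/1]_j e 0 j); first by elim/big_ind: _ => // x y; rewrite lt_min => -> .
  by move=> j; rewrite bigmin_le_cond.
exists c => //; have hA := pdmx_adj pA.
rewrite -(fcalc_cst c hA) -{2}(fcalc_id hA) /loewner_le fcalcB //.
by apply/(spectral_rep_psd (spectral_rep_fcalc _ sA)) => j; rewrite mxE subr_ge0.
Qed.

Lemma fcalcZ (R : realType) (c : R) (f : R -> R) n (A : 'M[R[i]]_n) :
  adjmx A = A -> (c%:C)%C *: fcalc f A = fcalc (fun x => c * f x) A.
Proof.
move=> hA; rewrite -(fcalcM (fun=> c) f hA) (fcalc_cst _ hA).
by rewrite mul_scalar_mx.
Qed.

Lemma fcalc_dilate (R : realType) (c : R) (f : R -> R) n (A : 'M[R[i]]_n) :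
  adjmx A = A -> fcalc f ((c%:C)%C *: A) = fcalc (fun x => f (c * x)) A.
Proof.
by move=> hA; rewrite -[X in _ *: X](fcalc_id hA) (fcalcZ c _ hA) (fcalc_comp _ _ hA).
Qed.

Lemma fcalc_sqrtM (R : realType) n (A : 'M[R[i]]_n) :
  psdmx A -> fcalc (@Num.sqrt R) A *m fcalc (@Num.sqrt R) A = A.
Proof.
move=> pA; have hA := psdmx_adj pA; rewrite (fcalcM _ _ hA) -[RHS](fcalc_id hA).
have [P [e sA]] := spectral_repP hA.
rewrite !(spectral_rep_fcalcE _ sA); congr (_ *m rdiag _ *m _).
apply/rowP=> j; rewrite !mxE -expr2 sqr_sqrtr //.
by move: j; apply/(spectral_rep_psd sA).
Qed.

Lemma loewnerZ (R : realType) (c : R) n (A B : 'M[R[i]]_n) : 0 <= c ->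
  loewner_le A B -> loewner_le ((c%:C)%C *: A) ((c%:C)%C *: B).
Proof. by rewrite /loewner_le -scalerBr; exact: psdmxZ. Qed.

Lemma loewnerD (R : realType) n (A B C D : 'M[R[i]]_n) :
  loewner_le A B -> loewner_le C D -> loewner_le (A + C) (B + D).
Proof. by rewrite /loewner_le opprD addrACA; exact: psdmxD. Qed.

Lemma loewner_psd (R : realType) n (A B : 'M[R[i]]_n) :
  psdmx A -> loewner_le A B -> psdmx B.
Proof. by move=> pA /psdmxD/(_ pA); rewrite subrK. Qed.

(** * Hansen's inequality *)

(* The difference of the two sides is [N Z N] for [N = sqrt eps P - Q / sqrt eps]. *)
Lemma pinching (R : realType) n (Z P Q : 'M[R[i]]_n) (eps : R) :
  0 < eps -> psdmx Z -> adjmx P = P -> adjmx Q = Q -> P + Q = 1%:M ->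
  loewner_le Z (((1 + eps)%:C)%C *: (P *m Z *m P)
                + ((1 + eps^-1)%:C)%C *: (Q *m Z *m Q)).
Proof.
move=> eps0 pZ hP hQ PQ; rewrite /loewner_le.
pose a := Num.sqrt eps.
have a0 : a != 0 by rewrite sqrtr_eq0 -ltNge.
have aa : eps = a * a by rewrite -expr2 sqr_sqrtr // ltW.
have hN : adjmx ((a%:C)%C *: P - ((a^-1)%:C)%C *: Q) = (a%:C)%C *: P - ((a^-1)%:C)%C *: Q.
  by rewrite adjmxB !adjmxZ hP hQ.
have := psdmx_congr ((a%:C)%C *: P - ((a^-1)%:C)%C *: Q) pZ; rewrite hN.
rewrite mulmxBl mulmxBl mulmxBr mulmxBr -!scalemxAl -!scalemxAr !scalerA.
have ZE : Z = P *m Z *m P + P *m Z *m Q + (Q *m Z *m P + Q *m Z *m Q).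
  by rewrite -!mulmxDr -mulmxDl -mulmxDl PQ mulmx1 mul1mx.
move: (P *m Z *m P) (Q *m Z *m Q) (P *m Z *m Q) (Q *m Z *m P) ZE => p q r s ->.
move=> pN; apply: (eq_ind _ (@psdmx R n) pN); rewrite -!rmorphM /= mulfV // mulVf //.
rewrite aa invfM; apply/matrixP=> i j; rewrite !mxE !rmorphD !rmorphM /=; ring.
Qed.

(* The pinching [W] of [Z] by [P = V V^*] satisfies [W V = V ((1 + eps) V^* Z V)],
   hence [h(W) V = V h((1 + eps) V^* Z V)], while [h(Z) <= h(W)]. *)
Lemma isometry_jensen (R : realType) (h : R -> R) m n (Z : 'M[R[i]]_n)
    (V : 'M[R[i]]_(n, m)) (eps : R) :
  matrix_monotone0 h -> 0 < eps -> psdmx Z -> adjmx V *m V = 1%:M ->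
  loewner_le (adjmx V *m fcalc h Z *m V)
    (fcalc h (((1 + eps)%:C)%C *: (adjmx V *m Z *m V))).
Proof.
move=> hm eps0 pZ VV.
have [P [Q [hP hQ PQ PZV QV]]] : exists P Q : 'M[R[i]]_n,
    [/\ adjmx P = P, adjmx Q = Q, P + Q = 1%:M,
     P *m Z *m P *m V = V *m (adjmx V *m Z *m V) & Q *m V = 0].
  have hP : adjmx (V *m adjmx V) = V *m adjmx V by rewrite adjmxM adjmxK.
  exists (V *m adjmx V), (1%:M - V *m adjmx V); split=> //.
  - by rewrite adjmxB adjmx1 hP.
  - by rewrite subrKC.
  - by rewrite -[_ *m V in LHS]mulmxA -[_ *m adjmx V *m V]mulmxA VV mulmx1 !mulmxA.
  - by rewrite mulmxBl mul1mx -mulmxA VV mulmx1 subrr.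
have := pinching eps0 pZ hP hQ PQ; set W := (W in loewner_le Z W) => ZW.
have WV : W *m V = V *m (((1 + eps)%:C)%C *: (adjmx V *m Z *m V)).
  by rewrite mulmxDl -!scalemxAl PZV -[Q *m Z *m Q *m V]mulmxA QV mulmx0 scaler0 addr0 scalemxAr.
have pW := loewner_psd pZ ZW.
apply: (@loewner_trans _ _ _ (adjmx V *m fcalc h W *m V)).
  exact: loewner_congr (hm _ _ _ pZ pW ZW).
rewrite -mulmxA (@fcalc_intertwine _ h _ _ W _ V _ _ WV) ?psdmx_adj //.
  by rewrite mulmxA VV mul1mx; exact: loewner_refl.
by apply: psdmxZ; [rewrite addr_ge0 // ltW|exact: psdmx_congr].
Qed.

(** The two coordinate inclusions intertwine the block diagonal matrix with its blocks, so the
    functional calculus acts blockwise. *)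
Lemma block_fcalc (R : realType) (h : R -> R) m n p (X : 'M[R[i]]_n) (Y : 'M[R[i]]_m)
    (K : 'M[R[i]]_(n, p)) (D : 'M[R[i]]_(m, p)) :
  adjmx X = X -> adjmx Y = Y ->
  fcalc h (block_mx X 0 0 Y) *m col_mx K D = col_mx (fcalc h X *m K) (fcalc h Y *m D).
Proof.
move=> hX hY.
have hZ : adjmx (block_mx X 0 0 Y) = block_mx X 0 0 Y.
  rewrite /adjmx tr_block_mx map_block_mx !trmx0 !map_mx0.
  by rewrite -/(adjmx X) -/(adjmx Y) hX hY.
have -> : col_mx K D = col_mx 1%:M 0 *m K + col_mx 0 1%:M *m D.
  by rewrite !mul_col_mx !mul1mx !mul0mx add_col_mx addr0 add0r.
rewrite mulmxDr !mulmxA (@fcalc_intertwine _ h _ _ _ X) //; last first.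
  by rewrite mul_block_col mul_col_mx !mulmx1 !mul0mx !mulmx0 mul1mx !addr0.
rewrite (@fcalc_intertwine _ h _ _ _ Y) //; last first.
  by rewrite mul_block_col mul_col_mx !mulmx1 !mul0mx !mulmx0 mul1mx !add0r.
by rewrite !mul_col_mx !mul1mx !mul0mx add_col_mx addr0 add0r.
Qed.

(* The defect operator [D] completes the contraction [K] to an isometry [V];
   the extra block [delta] of [Z] stays positive because [h 0] may be negative. *)
Lemma hansen_defect (R : realType) (h : R -> R) m n (X : 'M[R[i]]_n)
    (K : 'M[R[i]]_(n, m)) (eps delta : R) :
  matrix_monotone0 h -> (forall x : R, 0 < x -> 0 < h x) ->
  0 < eps -> 0 < delta -> psdmx X -> loewner_le (adjmx K *m K) 1%:M ->
  loewner_le (adjmx K *m fcalc h X *m K)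
    (fcalc h (((1 + eps)%:C)%C *: (adjmx K *m X *m K + (delta%:C)%C%:M))).
Proof.
move=> hm h0 eps0 delta0 pX K1.
have [D hD DD] : exists2 D : 'M[R[i]]_m, adjmx D = D & D *m D = 1%:M - adjmx K *m K.
  exists (fcalc (@Num.sqrt R) (1%:M - adjmx K *m K)); last exact: fcalc_sqrtM.
  exact/fcalc_adj/psdmx_adj.
have hX := psdmx_adj pX.
pose V := col_mx K D; pose dl : 'M[R[i]]_m := (delta%:C)%C%:M.
have hdl : adjmx dl = dl by exact: adjmx_scalar.
pose Z := block_mx X 0 0 dl.
have VE k (M : 'M[R[i]]_(n, k)) (N : 'M[R[i]]_(m, k)) :
    adjmx V *m col_mx M N = adjmx K *m M + D *m N.
  by rewrite adjmx_col mul_row_col hD.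
have VV : adjmx V *m V = 1%:M by rewrite VE DD subrKC.
have pdl : psdmx dl by apply: psdmx_scalar; exact: ltW.
have pZ : psdmx Z.
  split=> [|v].
    apply/hermsymmxP; rewrite /adjmx tr_block_mx map_block_mx !trmx0 !map_mx0.
    by rewrite -/(adjmx X) -/(adjmx dl) hX hdl.
  rewrite -[v]hsubmxK mul_row_block !mulmx0 addr0 add0r /adjmx tr_row_mx map_col_mx.
  by rewrite mul_row_col mxE addr_ge0 //; [exact: pX.2|exact: pdl.2].
(* Since [D *m D] is [1%:M - adjmx K *m K], it is at most the identity; the extra block then
   contributes at most [delta] times the identity. *)
have Dle (c : R) : 0 <= c -> loewner_le (D *m (c%:C)%C%:M *m D) ((c%:C)%C%:M).
  move=> c0; rewrite mul_mx_scalar -scalemxAl DD -[(c%:C)%C%:M]scalemx1.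
  apply: (loewnerZ c0); rewrite /loewner_le opprB subrKC.
  by have := psdmx_congr K (psdmx1 R n); rewrite mulmx1.
have VZV : adjmx V *m Z *m V = adjmx K *m X *m K + D *m dl *m D.
  by rewrite -mulmxA mul_block_col !mul0mx addr0 add0r VE !mulmxA.
have := isometry_jensen hm eps0 pZ VV.
rewrite -[adjmx V *m fcalc h Z *m V]mulmxA (block_fcalc h K D hX hdl) VE.
rewrite (fcalc_scalar h m delta) [adjmx K *m (fcalc h X *m K)]mulmxA.
rewrite [D *m (_ *m D)]mulmxA => le1.
(* The term coming from [h delta > 0] is positive semidefinite and is dropped from the smaller
   side. *)
apply: loewner_trans (loewner_trans le1 _).
  rewrite /loewner_le addrAC subrr add0r -{1}hD; apply: psdmx_congr.
  by apply: psdmx_scalar; exact/ltW/h0.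
have e1 : 0 <= 1 + eps by rewrite addr_ge0 // ltW.
have leZ : loewner_le (adjmx V *m Z *m V) (adjmx K *m X *m K + (delta%:C)%C%:M).
  by rewrite VZV; apply: loewnerD; [exact: loewner_refl|apply: Dle; exact: ltW].
apply: hm; last exact: loewnerZ e1 leZ.
  exact: psdmxZ e1 (psdmx_congr V pZ).
exact: psdmxZ e1 (psdmxD (psdmx_congr K pX) pdl).
Qed.

(** * Removing the error terms from Hansen's inequality *)

Lemma le_mul_gt1 (R : realType) (a b : R) :
  0 <= b -> (forall t : R, 1 < t -> a <= t * b) -> a <= b.
Proof.
move=> b0 ab; apply/ler_addgt0Pr => e e0.
have b1 : 0 < b + 1 by rewrite ltr_wpDl.
(* This factor raises [b] by [e * b / (b + 1) <= e]; the shift by 1 covers [b = 0]. *)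
have t1 : 1 < 1 + e / (b + 1) by rewrite ltrDl divr_gt0.
apply: (le_trans (ab _ t1)).
rewrite mulrDl mul1r lerD2l mulrAC ler_pdivrMr // ler_pM2l //.
by rewrite lerDl.
Qed.

(** Reduction to the scalar case through quadratic forms. It lets [t] tend to 1 and takes the place
    of a continuity argument for [h]. *)
Lemma loewner_le_mul_gt1 (R : realType) n (A B : 'M[R[i]]_n) :
  adjmx A = A -> psdmx B ->
  (forall t : R, 1 < t -> loewner_le A ((t%:C)%C *: B)) -> loewner_le A B.
Proof.
move=> hA pB AB; split; first by apply/hermsymmxP; rewrite adjmxB psdmx_adj // hA.
move=> v; rewrite mulmxBr mulmxBl !mxE subr_ge0.
have quad_real (M : 'M[R[i]]_n) : adjmx M = M ->
    exists x : R, (v *m M *m adjmx v) 0 0 = (x%:C)%C.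
  move=> hM; apply/complex_realP/CrealP.
  (* On a matrix of size one the adjoint is complex conjugation, so a Hermitian form takes real
     values. *)
  transitivity (adjmx (v *m M *m adjmx v) 0 0); first by rewrite !mxE.
  by rewrite !adjmxM adjmxK hM mulmxA.
have [a ea] := quad_real _ hA; have [b eb] := quad_real _ (psdmx_adj pB).
have b0 : 0 <= b by rewrite -ler0c -eb; exact: pB.2.
have <- : (v *m A *m adjmx v) 0 0 = \sum_j (v *m A) 0 j * adjmx v j 0 by rewrite mxE.
have <- : (v *m B *m adjmx v) 0 0 = \sum_j (v *m B) 0 j * adjmx v j 0 by rewrite mxE.
rewrite ea eb lecR; apply: le_mul_gt1 => // t t1.
have := (AB t t1).2 v.
rewrite mulmxBr mulmxBl -scalemxAr -scalemxAl [X in 0 <= X]mxE [X in _ + X]mxE.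
by rewrite [X in X - _]mxE ea eb -rmorphM -rmorphB ler0c subr_ge0.
Qed.

Lemma loewner_scalar1 (R : realType) (a b : R) :
  loewner_le ((a%:C)%C%:M : 'M_1) ((b%:C)%C%:M) <-> a <= b.
Proof.
rewrite /loewner_le -raddfB -rmorphB -subr_ge0; split=> [|/psdmx_scalar//].
by move=> /proj2/(_ 1%:M); rewrite mul1mx adjmx1 mulmx1 mxE eqxx mulr1n ler0c.
Qed.

(** This says that [h x / x] is nonincreasing. It is [hansen_defect] in dimension one with [X = y]
    and [K] the square root of [s = x / (t * y)], which gives [s * h y <= h x]; then [t] tends to
    1. *)
Lemma matrix_monotone0_div_le (R : realType) (h : R -> R) (x y : R) :
  matrix_monotone0 h -> (forall x : R, 0 < x -> 0 < h x) ->
  0 < x -> x <= y -> x * h y <= y * h x.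
Proof.
move=> hm h0 x0 xy; have y0 := lt_le_trans x0 xy.
apply: le_mul_gt1 => [|t t1]; first by rewrite mulr_ge0 // ltW // h0.
have t0 : 0 < t by apply: lt_trans t1.
pose s := x / (t * y).
have ty0 : 0 < t * y by apply: mulr_gt0.
have s0 : 0 <= s by rewrite divr_ge0 // ltW.
have s1 : s <= 1.
  rewrite ler_pdivrMr // mul1r (le_trans xy) // ler_peMl // ltW //.
(* As [s * y = x / t], the choices of [delta] and [eps] give [s * y + delta = x * (t + 1) / (2 * t)]
   and [1 + eps = 2 * t / (t + 1)], whose product is exactly [x]. *)
pose delta := x * (t - 1) / (2 * t).
have delta0 : 0 < delta by rewrite divr_gt0 // mulr_gt0 // subr_gt0.
pose eps := (t - 1) / (t + 1).
have eps0 : 0 < eps by rewrite divr_gt0 ?subr_gt0 // addr_gt0.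
pose k := Num.sqrt s; have kk : k * k = s by rewrite -expr2 sqr_sqrtr.
have := @hansen_defect R h 1%N 1%N ((y%:C)%C%:M) ((k%:C)%C%:M) eps delta hm h0
          eps0 delta0 (psdmx_scalar _ (ltW y0)).
have kMk (z : R) : adjmx ((k%:C)%C%:M) *m (z%:C)%C%:M *m (k%:C)%C%:M =
    ((s * z)%:C)%C%:M :> 'M[R[i]]_1.
  by rewrite adjmx_scalar -!scalar_mxM -!rmorphM mulrAC kk.
have -> : adjmx ((k%:C)%C%:M) *m (k%:C)%C%:M = (s%:C)%C%:M :> 'M[R[i]]_1.
  by rewrite adjmx_scalar -scalar_mxM -rmorphM kk.
have -> : 1%:M = ((1 : R)%:C)%C%:M :> 'M[R[i]]_1 by [].
rewrite fcalc_scalar !kMk -raddfD -rmorphD scale_scalar_mx -rmorphM fcalc_scalar.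
move=> /(_ (proj2 (loewner_scalar1 _ _) s1))/loewner_scalar1.
have -> : (1 + eps) * (s * y + delta) = x.
  rewrite /eps /s /delta; field.
  by rewrite !gt_eqF // addr_gt0.
by rewrite /s mulrAC ler_pdivrMr // [h x * _]mulrC mulrA.
Qed.

(** Let [Y = adjmx K *m X *m K]. Because [Y] is bounded below by a positive scalar [c], the errors
    of [hansen_defect] can be absorbed in a factor [t > 1], giving [h (t Y)]; this is at most
    [t h(Y)] as [h x / x] is nonincreasing. *)
Lemma hansen (R : realType) (h : R -> R) m n (X : 'M[R[i]]_n) (K : 'M[R[i]]_(n, m)) :
  matrix_monotone0 h -> (forall x : R, 0 < x -> 0 < h x) ->
  pdmx X -> loewner_le (adjmx K *m K) 1%:M -> pdmx (adjmx K *m X *m K) ->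
  loewner_le (adjmx K *m fcalc h X *m K) (fcalc h (adjmx K *m X *m K)).
Proof.
move=> hm h0 pX K1 pY; have psX := pdmx_psd pX.
have := fun e d e0 d0 => @hansen_defect R h m n X K e d hm h0 e0 d0 psX K1.
have hL : adjmx (adjmx K *m fcalc h X *m K) = adjmx K *m fcalc h X *m K.
  exact/adjmx_congr/fcalc_adj/pdmx_adj.
move: hL pY; move: (adjmx K *m fcalc h X *m K) (adjmx K *m X *m K) => L Y hL pY defect.
have hY := pdmx_adj pY; have psY := pdmx_psd pY.
apply: (loewner_le_mul_gt1 hL (pdmx_psd (fcalc_pd h0 pY))) => t t1.
have t0 : 0 < t by apply: lt_trans t1.
(* One factor [s] is [1 + eps]; the other absorbs [delta = (s - 1) * c], since [c <= Y] gives
   [Y + delta <= s Y]. *)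
pose s := Num.sqrt t.
have ss : s * s = t by rewrite -expr2 sqr_sqrtr // ltW.
have s0 : 0 <= s by apply: sqrtr_ge0.
have s1 : 1 < s by rewrite -sqrtr1 ltr_sqrt.
have e0 : 0 < s - 1 by rewrite subr_gt0.
have [c c0 cY] := pdmx_ge_scalar pY.
have d0 : 0 < (s - 1) * c by apply: mulr_gt0.
have := defect _ _ e0 d0; rewrite subrKC => le1.
have leY : loewner_le (Y + (((s - 1) * c)%:C)%C%:M) ((s%:C)%C *: Y).
  have -> : (s%:C)%C *: Y = Y + ((s - 1)%:C)%C *: Y.
    by rewrite -[X in X + _]scale1r -scalerDl -(rmorph1 (real_complex R)) -rmorphD subrKC.
  apply: loewnerD; first exact: loewner_refl.
  by rewrite rmorphM -scale_scalar_mx; apply: loewnerZ cY; exact: ltW.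
have psYd : psdmx (Y + (((s - 1) * c)%:C)%C%:M).
  exact: psdmxD psY (psdmx_scalar _ (ltW d0)).
apply: (loewner_trans le1).
have := hm _ _ _ (psdmxZ s0 psYd) (psdmxZ s0 (psdmxZ s0 psY)) (loewnerZ s0 leY).
move/loewner_trans; apply.
rewrite scalerA -rmorphM ss (fcalc_dilate _ _ hY) (fcalcZ _ _ hY).
apply: (fcalc_le pY) => x x0.
have xt : x <= t * x by apply: ler_peMl; exact: ltW.
have := matrix_monotone0_div_le hm h0 x0 xt.
by rewrite -[h (t * x) <= _](ler_pM2l x0) [x * (t * h x)]mulrCA mulrA.
Qed.

(** * Monotonicity of the mean *)

Lemma fcalc_sqrt_mulV (R : realType) n (A : 'M[R[i]]_n) :
  pdmx A -> fcalc (@Num.sqrt R) A *m fcalc (fun x => (Num.sqrt x)^-1) A = 1%:M.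
Proof.
move=> pA; have hA := pdmx_adj pA; rewrite (fcalcM _ _ hA).
rewrite (@fcalc_eq _ _ (fun=> 1) _ _ pA) ?(fcalc_cst _ hA) // => x x0.
by rewrite mulfV // gt_eqF // sqrtr_gt0.
Qed.

Record sqrt_pair (R : realType) n (A T T' : 'M[R[i]]_n) : Prop := SqrtPair {
  sqrt_adj : adjmx T = T;
  isqrt_adj : adjmx T' = T';
  sqrt_sq : T *m T = A;
  isqrt_sq : T' *m T' = fcalc (fun x => x^-1) A;
  sqrt_mulV : T *m T' = 1%:M;
  sqrt_Vmul : T' *m T = 1%:M;
  sqrt_fcalc f : T *m fcalc f A *m T = fcalc (fun x => x * f x) A;
  sqrt_msigma h B : msigma h A B = T *m fcalc h (T' *m B *m T') *m T
}.

(* Keeping the square roots abstract prevents unification from unfolding [fcalc]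
   when rewriting in products. *)
Lemma sqrt_pairP (R : realType) n (A : 'M[R[i]]_n) :
  pdmx A -> exists T T', sqrt_pair A T T'.
Proof.
move=> pA; have hA := pdmx_adj pA.
exists (fcalc (@Num.sqrt R) A), (fcalc (fun x => (Num.sqrt x)^-1) A).
have TT' := fcalc_sqrt_mulV pA; split.
- exact: fcalc_adj.
- exact: fcalc_adj.
- exact/fcalc_sqrtM/pdmx_psd.
- rewrite (fcalcM _ _ hA); apply: (fcalc_eq pA) => x x0.
  by rewrite -invfM -expr2 sqr_sqrtr // ltW.
- exact: TT'.
- exact: mulmx1C TT'.
- move=> f; rewrite (fcalcM _ _ hA) (fcalcM _ _ hA).
  by apply: (fcalc_eq pA) => x x0; rewrite mulrAC -expr2 sqr_sqrtr // ltW.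
- by [].
Qed.

Lemma sqrt_unit (R : realType) n (A T T' : 'M[R[i]]_n) :
  sqrt_pair A T T' -> T \in unitmx.
Proof. by move=> sA; case: (mulmx1_unit (sqrt_mulV sA)). Qed.

Lemma isqrt_unit (R : realType) n (A T T' : 'M[R[i]]_n) :
  sqrt_pair A T T' -> T' \in unitmx.
Proof. by move=> sA; case: (mulmx1_unit (sqrt_mulV sA)). Qed.

Lemma fcalc_sandwich (R : realType) (f g : R -> R) m n (C : 'M[R[i]]_n)
    (X : 'M[R[i]]_(n, m)) : adjmx C = C ->
  adjmx (fcalc f C *m X) *m fcalc g C *m (fcalc f C *m X)
    = adjmx X *m fcalc (fun x => f x * g x * f x) C *m X.
Proof.
move=> hC; rewrite adjmxM (fcalc_adj _ hC) -(fcalcM (fun x => f x * g x) f hC).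
rewrite -(fcalcM f g hC); move: (fcalc f C) (fcalc g C) => F G.
by rewrite !mulmxA.
Qed.

Lemma pdmx_sandwich (R : realType) n (A S : 'M[R[i]]_n) :
  adjmx S = S -> S \in unitmx -> pdmx A -> pdmx (S *m A *m S).
Proof. by move=> hS uS /(pdmx_congr uS); rewrite hS. Qed.

(* [Y A^(-1/2)] is unitary, and the functional calculus commutes with it. *)
Lemma msigma_factor (R : realType) (h : R -> R) n (M Y : 'M[R[i]]_n) :
  pdmx (adjmx Y *m Y) -> adjmx M = M ->
  msigma h (adjmx Y *m Y) (adjmx Y *m M *m Y) = adjmx Y *m fcalc h M *m Y.
Proof.
move=> pA hM; have [S [S' sA]] := sqrt_pairP pA; rewrite (sqrt_msigma sA).
have hS := sqrt_adj sA; have S'S := sqrt_Vmul sA; have SS' := sqrt_mulV sA.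
have [U UU YE] : exists2 U, adjmx U *m U = 1%:M & Y = U *m S.
  exists (Y *m S'); last by rewrite -mulmxA S'S mulmx1.
  rewrite adjmxM (isqrt_adj sA) -mulmxA [adjmx Y *m _]mulmxA -(sqrt_sq sA).
  by rewrite !mulmxA S'S mul1mx.
rewrite YE adjmxM hS.
have -> : S' *m (S *m adjmx U *m M *m (U *m S)) *m S' = adjmx U *m M *m U.
  by rewrite !mulmxA S'S mul1mx -!mulmxA SS' mulmx1.
have eU : adjmx U *m M *m U *m adjmx U = adjmx U *m M.
  by rewrite -mulmxA (mulmx1C UU) mulmx1.
have := fcalc_intertwine h (adjmx_congr U hM) hM eU.
move: (fcalc h (adjmx U *m M *m U)) (fcalc h M) => F G.
move=> /(congr1 (fun X => X *m U)); rewrite -[_ *m adjmx U *m U]mulmxA UU mulmx1 => ->.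
by rewrite !mulmxA.
Qed.

(** With [S] and [T] the square roots of [A1] and [A2], the matrix [K = S *m T'] is a contraction
    because [A1 <= A2], and it carries [S' *m B1 *m S'] to [T' *m B1 *m T']. Hansen's inequality
    thus replaces [A1] by [A2], monotonicity of [h] replaces [B1] by [B2], and conjugation by [T]
    concludes. *)
Lemma msigma_le (R : realType) (h : R -> R) n (A1 A2 B1 B2 : 'M[R[i]]_n) :
  matrix_monotone0 h -> (forall x : R, 0 < x -> 0 < h x) ->
  pdmx A1 -> pdmx A2 -> pdmx B1 -> pdmx B2 ->
  loewner_le A1 A2 -> loewner_le B1 B2 ->
  loewner_le (msigma h A1 B1) (msigma h A2 B2).
Proof.
move=> hm h0 pA1 pA2 pB1 pB2 leA leB.
have [S [S' sA1]] := sqrt_pairP pA1; have [T [T' sA2]] := sqrt_pairP pA2.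
rewrite (sqrt_msigma sA1) (sqrt_msigma sA2).
have hT' := isqrt_adj sA2; have uT' := isqrt_unit sA2.
have TT' := sqrt_mulV sA2; have T'T := sqrt_Vmul sA2.
have SS' := sqrt_mulV sA1; have S'S := sqrt_Vmul sA1.
have pX := pdmx_sandwich (isqrt_adj sA1) (isqrt_unit sA1) pB1.
have hK : adjmx (S *m T') = T' *m S by rewrite adjmxM hT' (sqrt_adj sA1).
have KK : loewner_le (adjmx (S *m T') *m (S *m T')) 1%:M.
  have := loewner_congr T' leA; rewrite hT' -(sqrt_sq sA1) -(sqrt_sq sA2) hK.
  by rewrite !mulmxA T'T mul1mx TT'.
have KXK : adjmx (S *m T') *m (S' *m B1 *m S') *m (S *m T') = T' *m B1 *m T'.
  rewrite hK !mulmxA -[T' *m S *m S']mulmxA SS' mulmx1.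
  by rewrite -[_ *m S' *m S]mulmxA S'S mulmx1.
have pY1 := pdmx_sandwich hT' uT' pB1; have pY2 := pdmx_sandwich hT' uT' pB2.
have := hansen hm h0 pX KK; rewrite KXK => /(_ pY1) le1.
have leY : loewner_le (T' *m B1 *m T') (T' *m B2 *m T').
  by have := loewner_congr T' leB; rewrite hT'.
have le2 := loewner_trans le1 (hm _ _ _ (pdmx_psd pY1) (pdmx_psd pY2) leY).
have := loewner_congr T le2; rewrite (sqrt_adj sA2) hK.
move: (fcalc h (S' *m B1 *m S')) => F.
have -> : T *m (T' *m S *m F *m (S *m T')) *m T = S *m F *m S.
  by rewrite !mulmxA TT' mul1mx -[_ *m T' *m T]mulmxA T'T mulmx1.
by [].
Qed.

(** * The Ando-Hiai step *)

(* The flag is [true] for the direct statement and [false] for the reversed one. *)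
Definition loewner_dir (R : realType) n (b : bool) (A B : 'M[R[i]]_n) :=
  if b then loewner_le A B else loewner_le B A.

Definition le_dir (R : realType) (b : bool) (x y : R) := if b then x <= y else y <= x.

Lemma loewner_dir_trans (R : realType) n b (A B C : 'M[R[i]]_n) :
  loewner_dir b A B -> loewner_dir b B C -> loewner_dir b A C.
Proof. by case: b => /= AB BC; [exact: loewner_trans AB BC|exact: loewner_trans BC AB]. Qed.

Lemma loewner_dir_congr (R : realType) m n b (A B : 'M[R[i]]_n) (X : 'M[R[i]]_(n, m)) :
  loewner_dir b A B -> loewner_dir b (adjmx X *m A *m X) (adjmx X *m B *m X).
Proof. by case: b; exact: loewner_congr. Qed.

Lemma loewner_dir_sandwich (R : realType) n b (A B S : 'M[R[i]]_n) :
  adjmx S = S -> loewner_dir b A B -> loewner_dir b (S *m A *m S) (S *m B *m S).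
Proof. by move=> hS /(loewner_dir_congr S); rewrite hS. Qed.

Lemma fcalc_dir (R : realType) b (f g : R -> R) n (A : 'M[R[i]]_n) :
  pdmx A -> (forall x : R, 0 < x -> le_dir b (f x) (g x)) ->
  loewner_dir b (fcalc f A) (fcalc g A).
Proof. by case: b => pA; exact: fcalc_le. Qed.

Lemma monotone_dir (R : realType) b (h : R -> R) n (A B : 'M[R[i]]_n) :
  matrix_monotone0 h -> pdmx A -> pdmx B ->
  loewner_dir b A B -> loewner_dir b (fcalc h A) (fcalc h B).
Proof. by move=> hm /pdmx_psd pA /pdmx_psd pB; case: b; exact: hm. Qed.

Lemma msigma_dir (R : realType) b (h : R -> R) n (A1 A2 B1 B2 : 'M[R[i]]_n) :
  matrix_monotone0 h -> (forall x : R, 0 < x -> 0 < h x) ->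
  pdmx A1 -> pdmx A2 -> pdmx B1 -> pdmx B2 ->
  loewner_dir b A1 A2 -> loewner_dir b B1 B2 ->
  loewner_dir b (msigma h A1 B1) (msigma h A2 B2).
Proof. by move=> hm h0 pA1 pA2 pB1 pB2; case: b; exact: msigma_le. Qed.

Lemma pdmx1 (R : realType) n : pdmx (1%:M : 'M[R[i]]_n).
Proof.
have s1 : spectral_rep 1%:M (const_mx 1) (1%:M : 'M[R[i]]_n).
  split; rewrite adjmx1 mulmx1 // mul1mx -diag_const_mx; congr diag_mx.
  by apply/rowP=> j; rewrite !mxE.
by apply/(spectral_rep_pd s1) => j; rewrite mxE.
Qed.

(* Conjugating [M^2 <= M] by [M^(-1/2)], where [M = K K^*]. *)
Lemma loewner_dir_mulC (R : realType) n b (K : 'M[R[i]]_n) :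
  K \in unitmx -> loewner_dir b (adjmx K *m K) 1%:M ->
  loewner_dir b (K *m adjmx K) 1%:M.
Proof.
move=> uK /(loewner_dir_congr (adjmx K)); rewrite adjmxK mulmx1.
have uK' : adjmx K \in unitmx.
  have := congr1 (@adjmx R n n) (mulVmx uK).
  by rewrite adjmxM adjmx1 => /mulmx1_unit[].
have pM : pdmx (K *m adjmx K).
  by have := pdmx_congr uK' (pdmx1 R n); rewrite adjmxK mulmx1.
have -> : K *m (adjmx K *m K) *m adjmx K = (K *m adjmx K) *m (K *m adjmx K).
  by rewrite !mulmxA.
move: (K *m adjmx K) pM => M pM; have [S [S' sM]] := sqrt_pairP pM.
have S'S := sqrt_Vmul sM; have SS' := sqrt_mulV sM.
move=> /(loewner_dir_congr S'); rewrite (isqrt_adj sM) -(sqrt_sq sM).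
by rewrite !mulmxA S'S mul1mx -!mulmxA SS' !mulmx1.
Qed.

(** Put [K = S *m T] with [S] the square root of [H]. The hypothesis bounds [adjmx K *m K];
    exchanging the factors bounds [S *m A *m S], and conjugation by the inverse of [S] isolates
    [A]. *)
Lemma loewner_dir_inv (R : realType) n b (A T H : 'M[R[i]]_n) :
  adjmx T = T -> T \in unitmx -> T *m T = A -> pdmx H ->
  loewner_dir b (T *m H *m T) 1%:M -> loewner_dir b A (fcalc (fun x => x^-1) H).
Proof.
move=> hT uT TT pH; have [S [S' sH]] := sqrt_pairP pH.
have S'S := sqrt_Vmul sH; have SS' := sqrt_mulV sH.
have hK : adjmx (S *m T) = T *m S by rewrite adjmxM hT (sqrt_adj sH).
have uK : S *m T \in unitmx by rewrite unitmx_mul (sqrt_unit sH).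
have -> : T *m H *m T = adjmx (S *m T) *m (S *m T).
  by rewrite hK -(sqrt_sq sH) !mulmxA.
move=> /(loewner_dir_mulC uK)/(loewner_dir_congr S').
rewrite (isqrt_adj sH) mulmx1 (isqrt_sq sH) hK.
by rewrite !mulmxA S'S mul1mx TT -!mulmxA SS' mulmx1.
Qed.

Lemma ando_hiai_step (R : realType) b n (A B : 'M[R[i]]_n) (g h : R -> R) :
  pdmx A -> pdmx B -> matrix_monotone0 g -> matrix_monotone0 h ->
  (forall x : R, 0 < x -> 0 < g x) -> (forall x : R, 0 < x -> 0 < h x) ->
  (forall x : R, 0 < x -> [/\ le_dir b (g (h x)^-1) (h (g x))^-1,
      le_dir b (g (x / h x)) (g x / h (g x)) & le_dir b (h (x * g x)) (h x * h (g x))]) ->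
  loewner_dir b (msigma h A B) 1%:M ->
  loewner_dir b (msigma h (fcalc (fun x => x * g x) A) (fcalc (fun x => x * g x) B)) 1%:M.
Proof.
move=> pA pB gm hm g0 h0 hyp; have hB := pdmx_adj pB.
have [T [T' sA]] := sqrt_pairP pA.
have hT := sqrt_adj sA; have uT := sqrt_unit sA.
have pC := pdmx_sandwich (isqrt_adj sA) (isqrt_unit sA) pB.
rewrite (sqrt_msigma sA).
have BE : B = T *m (T' *m B *m T') *m T.
  rewrite !mulmxA (sqrt_mulV sA) mul1mx -mulmxA (sqrt_Vmul sA).
  by rewrite mulmx1.
move: (T' *m B *m T') pC BE => C pC BE hyp1.
have hC := pdmx_adj pC; have [c [c' sC]] := sqrt_pairP pC.
have hc := sqrt_adj sC.
have hg0 (x : R) : 0 < x -> 0 < h (g x) by move=> x0; apply/h0/g0.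
have pos_a (x : R) : 0 < x -> 0 < (h (g x))^-1 by move=> x0; rewrite invr_gt0 hg0.
have pos_b (x : R) : 0 < x -> 0 < x * (g x / h (g x)).
  by move=> x0; rewrite mulr_gt0 // divr_gt0 ?hg0 // g0.
have pos_f (x : R) : 0 < x -> 0 < x * g x by move=> x0; rewrite mulr_gt0 // g0.
have pos_ih (x : R) : 0 < x -> 0 < (h x)^-1 by move=> x0; rewrite invr_gt0 h0.
have pos_xh (x : R) : 0 < x -> 0 < x / h x by move=> x0; rewrite divr_gt0 // h0.
have leA : loewner_dir b A (fcalc (fun x => (h x)^-1) C).
  rewrite -(fcalc_comp (fun x => x^-1) h hC).
  exact: loewner_dir_inv hT uT (sqrt_sq sA) (fcalc_pd h0 pC) hyp1.
have leFA : loewner_dir b (fcalc (fun x => x * g x) A)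
                          (T *m fcalc (fun x => (h (g x))^-1) C *m T).
  rewrite -(sqrt_fcalc sA g); apply: (loewner_dir_sandwich hT).
  apply: (loewner_dir_trans (monotone_dir gm pA (fcalc_pd pos_ih pC) leA)).
  rewrite (fcalc_comp _ _ hC); apply: (fcalc_dir pC) => x x0.
  by case: (hyp x x0).
have pcAc := pdmx_sandwich hc (sqrt_unit sC) pA.
(* Conjugating [leA] by the square root [c] of [C] compares [c *m A *m c] with [C / h(C)]; then [g]
   and (ii) apply. *)
have leg : loewner_dir b (fcalc g (c *m A *m c)) (fcalc (fun x => g x / h (g x)) C).
  have := loewner_dir_sandwich hc leA; rewrite (sqrt_fcalc sC) => lec.
  apply: (loewner_dir_trans (monotone_dir gm pcAc (fcalc_pd pos_xh pC) lec)).
  rewrite (fcalc_comp _ _ hC); apply: (fcalc_dir pC) => x x0.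
  by case: (hyp x x0).
have leFB : loewner_dir b (fcalc (fun x => x * g x) B)
                          (T *m fcalc (fun x => x * (g x / h (g x))) C *m T).
  (* With [L = T *m c] one has [B = L *m adjmx L] and [c *m A *m c = adjmx L *m L]. Hence
     [g(B) B = L g(adjmx L *m L) adjmx L], which turns the bound on [g(c *m A *m c)] into one on
     [f(B)]. *)
  have eB : B *m (T *m c) = (T *m c) *m (c *m A *m c).
    by rewrite BE -(sqrt_sq sC) -(sqrt_sq sA) !mulmxA.
  have gB : fcalc (fun x => x * g x) B = fcalc g B *m B.
    rewrite -[X in _ *m X](fcalc_id hB) (fcalcM _ _ hB).
    by apply: (fcalc_eq pB) => x x0; rewrite mulrC.
  have := fcalc_intertwine g hB (pdmx_adj pcAc) eB; rewrite gB.
  have := loewner_dir_congr (c *m T) leg.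
  rewrite adjmxM hc hT -(sqrt_fcalc sC).
  move: (fcalc g B) (fcalc g (c *m A *m c)) (fcalc _ C) => F G H leGH FG.
  have -> : F *m B = T *m c *m G *m (c *m T).
    by rewrite -FG {1}BE -(sqrt_sq sC) !mulmxA.
  by have -> : T *m (c *m H *m c) *m T = T *m c *m H *m (c *m T) by rewrite !mulmxA.
have pFA := fcalc_pd pos_f pA; have pFB := fcalc_pd pos_f pB.
have pa := pdmx_sandwich hT uT (fcalc_pd pos_a pC).
have pb := pdmx_sandwich hT uT (fcalc_pd pos_b pC).
apply: (loewner_dir_trans (msigma_dir hm h0 pFA pa pFB pb leFA leFB)).
apply: (loewner_dir_trans _ hyp1).
(* With [Y = q(C) T], the bounds on [f(A)] and [f(B)] become [adjmx Y *m Y] and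
   [adjmx Y *m f(C) *m Y], the shape in which [msigma_factor] computes their mean. *)
pose q x := (Num.sqrt (h (g x)))^-1.
have qq x : 0 < x -> q x * q x = (h (g x))^-1.
  by move=> x0; rewrite /q -invfM -expr2 sqr_sqrtr // ltW // hg0.
have eqT f1 f2 : (forall x, 0 < x -> f1 x = f2 x) ->
    T *m fcalc f1 C *m T = T *m fcalc f2 C *m T by move=> /(fcalc_eq pC)->.
have [Y YY] : exists Y, forall f, adjmx Y *m fcalc f C *m Y =
    T *m fcalc (fun x => (h (g x))^-1 * f x) C *m T.
  exists (fcalc q C *m T) => f; apply: (etrans (fcalc_sandwich q f T hC)).
  by rewrite hT; apply: eqT => x x0; rewrite mulrAC (qq _ x0).
have aE : T *m fcalc (fun x => (h (g x))^-1) C *m T = adjmx Y *m Y.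
  have := YY (fun=> 1); rewrite (fcalc_cst _ hC) rmorph1 mulmx1 => ->.
  by apply: eqT => x x0; rewrite mulr1.
have bE : T *m fcalc (fun x => x * (g x / h (g x))) C *m T =
    adjmx Y *m fcalc (fun x => x * g x) C *m Y.
  apply: etrans (esym (YY (fun x => x * g x))).
  by apply: eqT => x x0; rewrite mulrA mulrC.
have mE : msigma h (T *m fcalc (fun x => (h (g x))^-1) C *m T)
    (T *m fcalc (fun x => x * (g x / h (g x))) C *m T) =
    T *m fcalc (fun x => (h (g x))^-1 * h (x * g x)) C *m T.
  have mcongr (X X' Z Z' : 'M[R[i]]_n) :
    X = X' -> Z = Z' -> msigma h X Z = msigma h X' Z' by move=> -> ->.
  have pYY : pdmx (adjmx Y *m Y).
    rewrite -aE; exact: pa.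
  transitivity (msigma h (adjmx Y *m Y) (adjmx Y *m fcalc (fun x => x * g x) C *m Y)).
    exact: mcongr aE bE.
  apply: (etrans (msigma_factor h pYY (fcalc_adj _ hC))).
  by rewrite (fcalc_comp h _ hC); exact: YY.
(* What remains is [h (x * g x) / h (g x)] against [h x] on the spectrum of [C], which is (iii). *)
rewrite mE; apply: (loewner_dir_sandwich hT).
apply: (fcalc_dir pC) => x x0.
have [_ _] := hyp x x0.
case: (b) => /= le_h; rewrite [_^-1 * _]mulrC.
  by rewrite ler_pdivrMr // hg0.
by rewrite ler_pdivlMr // hg0.
Qed.

(** The conclusion of a step is the hypothesis of the next one for [f(A)] and [f(B)], which stay
    positive definite because [f] preserves the positive half-line. *)
Lemma ando_hiai_iter (R : realType) b n (A B : 'M[R[i]]_n) (g h : R -> R) k :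
  pdmx A -> pdmx B -> matrix_monotone0 g -> matrix_monotone0 h ->
  (forall x : R, 0 < x -> 0 < g x) -> (forall x : R, 0 < x -> 0 < h x) ->
  (forall x : R, 0 < x -> [/\ le_dir b (g (h x)^-1) (h (g x))^-1,
      le_dir b (g (x / h x)) (g x / h (g x)) & le_dir b (h (x * g x)) (h x * h (g x))]) ->
  loewner_dir b (msigma h A B) 1%:M ->
  loewner_dir b (msigma h (fcalc (iter k (fun x => x * g x)) A)
                          (fcalc (iter k (fun x => x * g x)) B)) 1%:M.
Proof.
move=> pA pB gm hm g0 h0 hyp AB1; have hA := pdmx_adj pA; have hB := pdmx_adj pB.
set f := fun x => x * g x.
have iter0 j (x : R) : 0 < x -> 0 < iter j f x.
  by move=> x0; elim: j => //= j IH; rewrite mulr_gt0 // g0.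
elim: k => [|k IH]; first by rewrite !fcalc_id.
rewrite -[fcalc _ A](fcalc_comp f (iter k f) hA) -[fcalc _ B](fcalc_comp f (iter k f) hB).
have pfA := fcalc_pd (iter0 k) pA; have pfB := fcalc_pd (iter0 k) pB.
exact: ando_hiai_step pfA pfB gm hm g0 h0 hyp IH.
Qed.

Theorem theorem2p10 (R : realType) (n : nat) (A B : 'M[R[i]]_n) (g h : R -> R) :
  pdmx A -> pdmx B ->
  matrix_monotone0 g -> matrix_monotone0 h ->
  (forall x : R, 0 < x -> 0 < g x) -> (forall x : R, 0 < x -> 0 < h x) ->
  let f := fun x : R => x * g x in
  ((forall x : R, 0 < x ->
       [/\ g (h x)^-1 <= (h (g x))^-1,
           g (x / h x) <= g x / h (g x)
         & h (x * g x) <= h x * h (g x)]) ->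
   forall k : nat, (0 < k)%N ->
     loewner_le (msigma h A B) 1%:M ->
     loewner_le (msigma h (fcalc (iter k f) A) (fcalc (iter k f) B)) 1%:M)
  /\
  ((forall x : R, 0 < x ->
       [/\ g (h x)^-1 >= (h (g x))^-1,
           g (x / h x) >= g x / h (g x)
         & h (x * g x) >= h x * h (g x)]) ->
   forall k : nat, (0 < k)%N ->
     loewner_le 1%:M (msigma h A B) ->
     loewner_le 1%:M (msigma h (fcalc (iter k f) A) (fcalc (iter k f) B))).
Proof.
move=> pA pB gm hm g0 h0 f; split=> hyp k _ AB1.
  (* At a fixed flag [le_dir] and [loewner_dir] reduce to the plain orders, so the hypotheses match
     by conversion. *)
  exact: (@ando_hiai_iter R true n A B g h k pA pB gm hm g0 h0 hyp AB1).
exact: (@ando_hiai_iter R false n A B g h k pA pB gm hm g0 h0 hyp AB1).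
Qed.
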